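(* If $Q$ is a commutative, latin or simple quandle, then $Q$ is a $(G,A)$-quandle, i.e. there exist a group $G$ and a subset $A$ of $G$ such that $Q$ is isomorphic to $Q(G,A)$.
   Context: A quandle is a set $Q$ with a binary operation $*$ such that: (r1) for every $x\in Q$ the map $S_x:y\mapsto y*x$ is a bijection of $Q$; (r2) $(x*y)*z=(x*z)*(y*z)$ for all $x,y,z\in Q$; (q1) $x*x=x$ for all $x\in Q$. A quandle $Q$ is commutative if $x*y=y*x$ for all $x,y\in Q$. It is latin if for every pair $x,y\in Q$ there exists a unique $z\in Q$ with $x=y*z$. It is simple if every quandle homomorphism $Q\to P$ (to any quandle $P$) is either injective or constant. For a group $G$ and a subset $A\subseteq G$, the $(G,A)$-quandle $Q(G,A)$ is the quotient of the set $A\times G$ by the equivalence relation $(a,gh)\sim(a,h)$ for $a\in A$, $h\in G$, $g\in C_G(a)=\{x\in G\mid xa=ax\}$, with the (well-defined) quandle operation $[(a,u)]*[(b,v)]=[(a,uv^{-1}bv)]$. *)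

(* Defs.v *)
From HB Require Import structures.
From mathcomp Require Import all_boot generic_quotient.
From mathcomp Require Import boolp classical_sets.

Set Implicit Arguments.
Unset Strict Implicit.
Unset Printing Implicit Defensive.

Declare Scope quandle_scope.
Delimit Scope quandle_scope with qdl.
Reserved Notation "x ** y" (at level 40, left associativity).

HB.mixin Record isQuandle Q := {
  qop : Q -> Q -> Q;
  qop_bij : forall x, bijective (fun y => qop y x);
  qop_distr : forall x y z, qop (qop x y) z = qop (qop x z) (qop y z);
  qop_idem : forall x, qop x x = x
}.

#[short(type="quandleType")]
HB.structure Definition Quandle := {Q of isQuandle Q}.

Notation "x ** y" := (qop x y) : quandle_scope.
Local Open Scope quandle_scope.

Definition quandle_hom (Q P : quandleType) (f : Q -> P) : Prop :=
  forall x y, f (x ** y) = f x ** f y.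

Definition quandle_iso (Q P : quandleType) : Prop :=
  exists2 f : Q -> P, quandle_hom f & bijective f.

Definition commutative_quandle (Q : quandleType) : Prop :=
  forall x y : Q, x ** y = y ** x.

Definition latin_quandle (Q : quandleType) : Prop :=
  forall x y : Q, exists! z : Q, x = y ** z.

Definition simple_quandle (Q : quandleType) : Prop :=
  forall (P : quandleType) (f : Q -> P), quandle_hom f ->
    injective f \/ (forall x y, f x = f y).

Section GAQuandle.
Variables (G : groupType) (A : set G).
Local Open Scope group_scope.

Definition ga_rel : rel (A * G) := fun p q =>
  `[< exists2 g : G, commute g (val p.1) & p.1 = q.1 /\ p.2 = g * q.2 >].

Lemma ga_relP p q :
  reflect (exists2 g : G, commute g (val p.1) & p.1 = q.1 /\ p.2 = g * q.2)
          (ga_rel p q).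
Proof. exact: asboolP. Qed.

Lemma ga_rel_refl : reflexive ga_rel.
Proof.
move=> p; apply/ga_relP; exists 1; last by rewrite mul1g.
exact/commute_sym/commute1.
Qed.

Lemma ga_rel_sym : symmetric ga_rel.
Proof.
suff H p q : ga_rel p q -> ga_rel q p by move=> p q; apply/idP/idP; apply: H.
move=> /ga_relP[g cga [e1 e2]]; apply/ga_relP; exists g^-1.
  by rewrite -e1; apply/commute_sym/commuteV/commute_sym.
by rewrite e1 e2 mulKg.
Qed.

Lemma ga_rel_trans : transitive ga_rel.
Proof.
move=> q p r /ga_relP[g cg [e1 e2]] /ga_relP[h ch [e3 e4]].
apply/ga_relP; exists (g * h); last by rewrite e1 e3 e2 e4 mulgA.
by apply/commute_sym/commuteM; apply: commute_sym => //; rewrite e1.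
Qed.

Canonical ga_equiv := EquivRel ga_rel ga_rel_refl ga_rel_sym ga_rel_trans.

Local Open Scope quotient_scope.

Definition ga_quandle : Type := {eq_quot ga_rel}.

Definition ga_class (p : A * G) : ga_quandle := \pi_{eq_quot ga_rel} p.

Definition ga_pre_op (p q : A * G) : A * G :=
  (p.1, p.2 * q.2^-1 * val q.1 * q.2).

(* Computed on representatives; ga_opE shows independence of the choice. *)
Definition ga_op (X Y : ga_quandle) : ga_quandle :=
  ga_class (ga_pre_op (repr (X : {eq_quot ga_rel}))
                      (repr (Y : {eq_quot ga_rel}))).

Lemma ga_classP p q : ga_class p = ga_class q <-> ga_rel p q.
Proof. by split=> [/eqmodP|/eqmodP]. Qed.

Lemma ga_class_surj (X : ga_quandle) : exists p, X = ga_class p.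
Proof. by exists (repr (X : {eq_quot ga_rel})); rewrite /ga_class reprK. Qed.

Lemma ga_opE p q : ga_op (ga_class p) (ga_class q) = ga_class (ga_pre_op p q).
Proof.
rewrite /ga_op; set p' := repr _; set q' := repr _.
have /ga_classP/ga_relP[g cg [ep ep2]] : ga_class p' = ga_class p.
  by rewrite /ga_class /p' reprK.
have /ga_classP/ga_relP[h ch [eq eq2]] : ga_class q' = ga_class q.
  by rewrite /ga_class /q' reprK.
apply/ga_classP/ga_relP; exists g => //; split=> //=.
rewrite ep2 eq2 invgM -!mulgA; congr (_ * (_ * (_ * _))).
rewrite (mulgA (val q'.1)) -ch -eq !mulgA.
by rewrite mulVg mul1g.
Qed.

Lemma ga_op_bij Y : bijective (fun X => ga_op X Y).
Proof.
have [[b v] ->] := ga_class_surj Y.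
pose inv (X : ga_quandle) := let p := repr (X : {eq_quot ga_rel}) in
  ga_class (p.1, p.2 * v^-1 * (val b)^-1 * v).
have invE p : inv (ga_class p) = ga_class (p.1, p.2 * v^-1 * (val b)^-1 * v).
  rewrite /inv /=; set p' := repr _.
  have /ga_classP/ga_relP[g cg [ep ep2]] : ga_class p' = ga_class p.
    by rewrite /ga_class /p' reprK.
  by apply/ga_classP/ga_relP; exists g => //=; rewrite ep ep2 !mulgA.
exists inv => X; have [[a u] ->] := ga_class_surj X;
  by rewrite ?(ga_opE, invE) /ga_pre_op /= !(mulgK, mulgVK).
Qed.

Lemma ga_op_distr X Y Z :
  ga_op (ga_op X Y) Z = ga_op (ga_op X Z) (ga_op Y Z).
Proof.
have [[[a u] ->] [[b v] ->] [[c w] ->]] :=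
  And3 (ga_class_surj X) (ga_class_surj Y) (ga_class_surj Z).
rewrite !ga_opE /ga_pre_op /=; congr (ga_class (_, _)).
by rewrite !invgM !invgK !mulgA ?mulgK !mulgVK.
Qed.

Lemma ga_op_idem X : ga_op X X = X.
Proof.
have [[a u] ->] := ga_class_surj X; rewrite ga_opE.
apply/ga_classP/ga_relP; exists (val a) => //=.
by rewrite mulgV mul1g.
Qed.

HB.instance Definition _ :=
  isQuandle.Build ga_quandle ga_op_bij ga_op_distr ga_op_idem.

End GAQuandle.

(* Main.v *)
Require Import Defs.
From HB Require Import structures.
From mathcomp Require Import all_boot.
From mathcomp Require Import fingroup zmodp.
From mathcomp Require Import boolp classical_sets.

(** The class of [(a, u)] in Q(G, A) is determined by [a] and the conjugate
    [a ^ u]; if A meets every conjugacy class at most once, it is determined by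
    [a ^ u] alone.  Hence a quandle embedded in a group under conjugation, with
    image a union of conjugacy classes, is Q(G, A) for A a set of representatives
    of these classes.  The right translations map Q homomorphically into Aut Q
    under conjugation, with conjugation-invariant image; this map is injective
    when Q is commutative or latin.  When Q is simple, it is injective or
    constant, and in the latter case Q is trivial with at most two elements, so
    that it embeds in the abelian group Z/2. *)

Set Implicit Arguments.
Unset Strict Implicit.
Unset Printing Implicit Defensive.

Local Open Scope group_scope.
Local Open Scope quandle_scope.

Definition conj_quandle (G : groupType) : Type := G.

Section ConjQuandle.
Variable G : groupType.

Lemma conjg_bij (x : G) : bijective (fun y : G => y ^ x).
Proof. by exists (conjg^~ x^-1) => y; rewrite ?conjgK ?conjgKV. Qed.

Lemma conjg_idem (x : G) : x ^ x = x.
Proof. by rewrite conjgE mulKg. Qed.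

HB.instance Definition _ :=
  isQuandle.Build (conj_quandle G) conjg_bij (@conjJg G) conjg_idem.

End ConjQuandle.

Section ConjugationRepresentatives.
Variable G : groupType.

Definition conj_rep (g : G) : G :=
  choose (fun h => `[< exists k, h = g ^ k >]) g.

Lemma conj_repP (g : G) : exists k, g = conj_rep g ^ k.
Proof.
have /asboolP[k ->] : `[< exists k, conj_rep g = g ^ k >].
  by apply: (@chooseP G (fun h => `[< exists k, h = g ^ k >]));
    apply/asboolP; exists 1; rewrite conjg1.
by exists k^-1; rewrite conjgK.
Qed.

(** Conjugate elements have the same class as predicate, and [choose] does not depend on its
    starting point within that class. *)
Lemma conj_repJ (g k : G) : conj_rep (g ^ k) = conj_rep g.
Proof.
rewrite /conj_rep.
under eq_choose => h.
  have -> : `[< exists l, h = (g ^ k) ^ l >] = `[< exists l, h = g ^ l >].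
    apply: asbool_equiv_eq; split=> -[l ->]; last first.
      by exists (k^-1 * l); rewrite conjgM conjgK.
    by exists (k * l); rewrite conjgM.
  over.
by apply: choose_id; apply/asboolP; [exists k | exists 1; rewrite conjg1].
Qed.

Lemma conj_rep_idem (g : G) : conj_rep (conj_rep g) = conj_rep g.
Proof. by have [k {2}->] := conj_repP g; rewrite conj_repJ. Qed.

Lemma ga_class_conjP (A : set G) (p q : A * G) :
  {in A &, injective conj_rep} ->
  ga_class p = ga_class q <-> val p.1 ^ p.2 = val q.1 ^ q.2.
Proof.
move=> injA; rewrite ga_classP; split.
  move=> /ga_relP[g cg [<- ->]].
  by rewrite conjgM [val p.1 ^ g]conjgE -cg mulKg.
move=> e.
have e1 : p.1 = q.1.
  apply: val_inj; apply: injA; [exact: valP | exact: valP |].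
  by rewrite -(conj_repJ _ p.2) e conj_repJ.
(* The equation [p.2 = g * q.2] forces this witness; it fixes [val p.1] under conjugation by [e], so
   it commutes with it. *)
apply/ga_relP; exists (p.2 * q.2^-1).
  by apply/commute_sym/commgP/conjg_fixP; rewrite conjgM e -e1 conjgK.
by rewrite mulgVK.
Qed.

Lemma conj_embedding_ga (Q : quandleType) (s : Q -> conj_quandle G) :
    quandle_hom s -> injective s ->
    (forall x (g : G), exists y, s y = (s x : G) ^ g) ->
  quandle_iso Q (ga_quandle (range (fun x => conj_rep (s x)))).
Proof.
move=> s_hom s_inj s_conj; set A := range _.
have A_inj : {in A &, injective conj_rep}.
  by move=> _ _ /set_mem[x _ <-] /set_mem[y _ <-]; rewrite !conj_rep_idem.
have clP (p q : A * G) := ga_class_conjP p q A_inj.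
have [f fP] : {f : Q -> A * G & forall x, val (f x).1 ^ (f x).2 = s x}.
  apply: (@choice Q (A * G) (fun x p => val p.1 ^ p.2 = s x)) => x.
  have [k ek] := conj_repP (s x).
  have Ax : conj_rep (s x) \in A by apply/mem_set; exists x.
  by exists (SigSub Ax, k).
have [r rP] : {r : ga_quandle A -> Q & forall X, ga_class (f (r X)) = X}.
  apply: (@choice _ _ (fun X x => ga_class (f x) = X)) => X.
  have [[a v] ->] := ga_class_surj X.
  have /set_mem[x _ ax] := valP a.
  (* Conjugating by [k^-1] brings [s x] back to its representative [val a]; [v] then leads to
     [val a ^ v]. *)
  have [k ek] := conj_repP (s x); have [y ey] := s_conj x (k^-1 * v).
  by exists y; apply/clP; rewrite fP ey /= -ax {1}ek -conjgM mulVKg.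
have f_hom : quandle_hom (fun x => ga_class (f x)).
  (* Both sides agree because [a ^ (u * v^-1 * b * v) = (a ^ u) ^ (b ^ v)]. *)
  move=> x y; rewrite [RHS]ga_opE; apply/clP.
  rewrite fP s_hom /ga_pre_op /= -!mulgA conjgM fP; congr (_ ^ _).
  by rewrite -fP conjgE.
exists (fun x => ga_class (f x)) => //; exists r => // x.
by apply: s_inj; rewrite -!fP; apply/clP.
Qed.

End ConjugationRepresentatives.

Section Automorphisms.
Variable Q : quandleType.

Record quandle_aut := QuandleAut {
  aut_fun :> Q -> Q;
  aut_inv : Q -> Q;
  aut_funK : cancel aut_fun aut_inv;
  aut_invK : cancel aut_inv aut_fun;
  aut_hom : quandle_hom aut_fun
}.

(** The forward map determines its inverse, and the other fields are proofs. *)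
Lemma quandle_autP (f g : quandle_aut) : f =1 g -> f = g.
Proof.
case: f g => [f f' fK f'K fM] [g g' gK g'K gM] /= fg.
have ef : f = g by apply: funext.
rewrite -ef in gK g'K gM *.
have ef' : f' = g' by apply: funext => x; rewrite -[in LHS](g'K x) fK.
rewrite -ef' in gK g'K *.
by congr QuandleAut; apply: Prop_irrelevance.
Qed.

Lemma quandle_hom_inv (f g : Q -> Q) :
  cancel f g -> cancel g f -> quandle_hom f -> quandle_hom g.
Proof. by move=> fK gK fM x y; apply: (can_inj fK); rewrite fM !gK. Qed.

Lemma quandle_hom_comp (f g : Q -> Q) :
  quandle_hom f -> quandle_hom g -> quandle_hom (g \o f).
Proof. by move=> fM gM x y /=; rewrite fM gM. Qed.

Definition aut_one : quandle_aut :=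
  @QuandleAut id id (fun=> erefl) (fun=> erefl) (fun _ _ => erefl).

Definition aut_opp (f : quandle_aut) : quandle_aut :=
  QuandleAut (aut_invK f) (aut_funK f)
    (quandle_hom_inv (aut_funK f) (aut_invK f) (aut_hom f)).

(* Automorphisms act on the right, so the left factor is applied first. *)
Definition aut_mul (f g : quandle_aut) : quandle_aut :=
  QuandleAut (can_comp (aut_funK g) (aut_funK f))
    (can_comp (aut_invK f) (aut_invK g))
    (quandle_hom_comp (aut_hom f) (aut_hom g)).

Lemma aut_mulA : associative aut_mul.
Proof. by move=> f g h; apply: quandle_autP. Qed.

Lemma aut_mul1 : left_id aut_one aut_mul.
Proof. by move=> f; apply: quandle_autP. Qed.

Lemma aut_mulr1 : right_id aut_one aut_mul.
Proof. by move=> f; apply: quandle_autP. Qed.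

Lemma aut_mulV : left_inverse aut_one aut_opp aut_mul.
Proof. by move=> f; apply: quandle_autP => x; apply: aut_invK. Qed.

Lemma aut_mulrV : right_inverse aut_one aut_opp aut_mul.
Proof. by move=> f; apply: quandle_autP => x; apply: aut_funK. Qed.

HB.instance Definition _ := gen_eqMixin quandle_aut.
HB.instance Definition _ := gen_choiceMixin quandle_aut.
HB.instance Definition _ :=
  isGroup.Build quandle_aut aut_mulA aut_mul1 aut_mulr1 aut_mulV aut_mulrV.

(** [qop_bij] only asserts that inverses exist, so choice has to select them. *)
Lemma translation_exists :
  exists S : Q -> quandle_aut, forall x y, S x y = y ** x.
Proof.
suff /choice[S SP] : forall x, exists f : quandle_aut, forall y, f y = y ** x.
  by exists S.
move=> x; have [g gK g'K] := qop_bij x.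
by exists (@QuandleAut (fun y => y ** x) g gK g'K (fun y z => qop_distr y z x)).
Qed.

Variable S : Q -> quandle_aut.
Hypothesis SE : forall x y, S x y = y ** x.

(** As [g] is a homomorphism, [g (g^-1 y ** x) = y ** g x]. *)
Lemma translationJ (g : quandle_aut) x : S (g x) = S x ^ g.
Proof.
apply: quandle_autP => y; rewrite SE.
have -> : (S x ^ g) y = g (S x (aut_inv g y)) by [].
by rewrite SE aut_hom aut_invK.
Qed.

(** Since [x ** y] is [S y x], this is [translationJ] for the automorphism [S y]. *)
Lemma translation_hom : quandle_hom (S : Q -> conj_quandle quandle_aut).
Proof. by move=> x y; rewrite -SE; apply: translationJ. Qed.

Lemma faithful_ga :
    injective S ->
  exists (G : groupType) (A : set G), quandle_iso Q (ga_quandle A).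
Proof.
move=> S_inj; exists quandle_aut; eexists.
apply: (conj_embedding_ga translation_hom S_inj) => x g.
by exists (g x); apply: translationJ.
Qed.

End Automorphisms.

Lemma trivial_simple_ga (Q : quandleType) :
    (forall x y : Q, x ** y = x) -> simple_quandle Q ->
  exists (G : groupType) (A : set G), quandle_iso Q (ga_quandle A).
Proof.
move=> trivQ simpQ; pose C := conj_quandle 'I_2.
have conj_triv (x y : 'I_2) : x ^ y = x by rewrite conjgE Zp_mulgC mulgK.
have homC (f : Q -> C) : quandle_hom f.
  by move=> x y; rewrite trivQ; apply/esym/conj_triv.
suff [f f_inj] : exists f : Q -> C, injective f.
  exists 'I_2; eexists; apply: (conj_embedding_ga (homC f) f_inj) => x g.
  by exists x; rewrite conj_triv.
pose f (a x : Q) : C := inord `[< x = a >] : 'I_2.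
have [[a fa]|noinj] := pselect (exists a, injective (f a)).
  by exists (f a).
(* Otherwise every indicator [f a] is constant, so [f a b = f a a = 1] and [b = a]: even a constant
   map is injective. *)
exists (fun=> ord0) => a b _.
have [fa|/(_ a b)/(congr1 val)] := simpQ C (f a) (homC _).
  by case: noinj; exists a.
rewrite /f /= !inordK ?ltnS ?leq_b1 // asboolT //.
by case: asboolP.
Qed.

Theorem corollary5p1 (Q : quandleType) :
  commutative_quandle Q \/ latin_quandle Q \/ simple_quandle Q ->
  exists (G : groupType) (A : set G), quandle_iso Q (ga_quandle A).
Proof.
have [S SE] := translation_exists Q.
have eqS x y : S x = S y -> forall z, z ** x = z ** y.
  by move=> eS z; rewrite -!SE eS.
case=> [comQ | [latQ | simpQ]].
- apply: (faithful_ga SE) => x y /eqS e.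
  (* [x = x ** x = x ** y = y ** x = y ** y = y]. *)
  by rewrite -[LHS]qop_idem e comQ e qop_idem.
- apply: (faithful_ga SE) => x y /eqS e.
  (* Both [x] and [y] solve [x ** x = x ** z] for [z]. *)
  by have [z [_ uz]] := latQ (x ** x) x; rewrite -(uz x) // (uz y) ?e.
have [S_inj|S_const] := simpQ _ _ (translation_hom SE).
  exact: faithful_ga SE S_inj.
apply: trivial_simple_ga => // x y.
(* Equal translations give [x ** y = x ** x = x]. *)
by rewrite -[RHS]qop_idem (eqS y x).
Qed.
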